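(* Let $d$ be a prime number and $1\le n\le m$ integers. For every isometry $V\in \mathrm{U}(\mathcal{H}_{d}^{\otimes n},\mathcal{H}_{d}^{\otimes m})$, there exists a quantum circuit (composed of SUM gates and single-qudit gates) for implementing $V$ using $m-n$ ancilla qudits initialized to $|0\rangle^{\otimes(m-n)}$, such that the number of SUM gates in the circuit is at most $d\,N(d,n,m)$, where $$N(d,n,m)=4d^n\Big(\frac{d^m-1}{d-1}-m\Big)+d^nN_{\mathrm{U}}(d,m).$$
   Context: $N_{\mathrm{U}}(d,m)=2+\sum_{r=3}^{m}\min\{N_{\mathrm{SU}}^{\mathrm{rec}}(r),N_{\mathrm{SU}}(d,r)\}$ (the sum being empty, i.e. $N_{\mathrm U}(d,m)=2$, for $m\le2$), where for $3\le r\le6$ the minimum is taken to be $N_{\mathrm{SU}}^{\mathrm{rec}}(r)$. Here, for $r\ge3$, $N^{\mathrm{rec}}_{\mathrm{SU}}(r)=2^{2k}+3\cdot 2^{k}(r-2^{k}-1)$ with $k=\lfloor\log_2(r-1)\rfloor$; and for $r\ge 7$, $N_{\mathrm{SU}}(d,r)$ equals $16r-48$ if $d=2$, $32r-160$ if $d=3$, and $(32d-40)r-192d+272$ if $d\ge4$. $\mathcal{H}_{d}$ is a $d$-dimensional complex Hilbert space with orthonormal (computational) basis $|0\rangle,\dots,|d-1\rangle$ (a qudit). $\mathrm{U}(\mathcal{H}_{d}^{\otimes n},\mathcal{H}_{d}^{\otimes m})$ is the set of linear operators $V:\mathcal{H}_d^{\otimes n}\to\mathcal{H}_d^{\otimes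 m}$ with $V^\dagger V=I$. $X_d=|0\rangle\langle d-1|+\sum_{a=0}^{d-2}|a+1\rangle\langle a|$. A SUM gate on $m$ qudits is, for some $i\neq j$, the unitary that applies $X_d^{x_i}$ to the $j$-th tensor factor of each computational basis vector $|x_1\dots x_m\rangle$. A single-qudit gate is an arbitrary unitary acting nontrivially on one tensor factor only. A circuit implementing $V$ with $m-n$ ancilla qudits is a finite product $U$ of SUM gates and single-qudit gates on $m$ qudits with $U(|0\rangle^{\otimes(m-n)}\otimes|\psi\rangle)=V|\psi\rangle$ for every $|\psi\rangle\in\mathcal{H}_d^{\otimes n}$. *)

(* Defs.v *)
From HB Require Import structures.
From mathcomp Require Import all_boot all_order all_algebra.
From mathcomp Require Import spectral.
From mathcomp Require Import reals complex.

Set Implicit Arguments.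
Unset Strict Implicit.
Unset Printing Implicit Defensive.

Import Order.TTheory GRing.Theory Num.Theory.
Local Open Scope ring_scope.
Local Open Scope sesquilinear_scope.

(** ** Gate-count bounds *)

(* Bounds in nat.  For d >= 2, with r >= 3 in [N_SU_rec] and r >= 7 in [N_SU],
   no subtraction is truncated and the division in [N_isometry] is exact, so
   the values agree with the integer formulas.  In the last branch of [N_SU]
   the constant 272 is added before 192 d is subtracted because
   (32 d - 40) r may be smaller than 192 d. *)

Definition N_SU_rec (r : nat) : nat :=
  let k := trunc_log 2 (r - 1) in
  (2 ^ (2 * k) + 3 * 2 ^ k * (r - 2 ^ k - 1))%N.

Definition N_SU (d r : nat) : nat :=
  if (d == 2)%N then (16 * r - 48)%N
  else if (d == 3)%N then (32 * r - 160)%N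
  else ((32 * d - 40) * r + 272 - 192 * d)%N.

Definition N_U (d m : nat) : nat :=
  (2 + \sum_(3 <= r < m.+1)
         (if (r <= 6)%N then N_SU_rec r else minn (N_SU_rec r) (N_SU d r)))%N.

Definition N_isometry (d n m : nat) : nat :=
  (4 * d ^ n * ((d ^ m - 1) %/ (d - 1) - m) + d ^ n * N_U d m)%N.

(** ** Qudit registers *)

(* Labels x = (x_1, ..., x_n) of the computational basis of n qudits. *)
Definition label (d n : nat) : finType := {ffun 'I_n -> 'I_d}.

(* Column vectors and matrices in the computational basis; rows and columns
   are indexed by labels through [enum_rank] and [enum_val]. *)
Definition state (C : Type) (d n : nat) := 'cV[C]_(#|label d n|).
Definition operator (C : Type) (d n m : nat) :=
  'M[C]_(#|label d m|, #|label d n|).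

Section Circuits.
Variables (R : realType) (d : nat).
Local Notation C := R[i].

Definition amp n (psi : state C d n) (x : label d n) : C :=
  psi (enum_rank x) 0.

Definition mkstate n (f : label d n -> C) : state C d n :=
  \col_i f (enum_val i).

(* [f y x] is the matrix entry <y| A |x>. *)
Definition mkop n m (f : label d m -> label d n -> C) : operator C d n m :=
  \matrix_(i, j) f (enum_val i) (enum_val j).

Definition ket0 n : state C d n :=
  mkstate (fun x => [forall k, x k == 0 :> nat]%N%:R).

(* The first p tensor factors carry phi, the last q carry psi. *)
Definition tensor p q m (e : (p + q)%N = m)
    (phi : state C d p) (psi : state C d q) : state C d m :=
  mkstate (fun x =>
    amp phi [ffun i => x (cast_ord e (lshift q i))] *
    amp psi [ffun i => x (cast_ord e (rshift p i))]).

Definition is_isometry n m (V : operator C d n m) : Prop := V ^t* *m V = 1%:M.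

(* [ordS a] is a + 1 modulo d. *)
Definition shiftX : 'M[C]_d := \matrix_(b, a) (b == ordS a)%:R.

(* Matrix entry <y| A_j |x>, where A_j is A acting on the j-th tensor factor
   and the identity on all the others. *)
Definition local_entry m (j : 'I_m) (A : 'M[C]_d) (y x : label d m) : C :=
  if [forall (k | k != j), y k == x k] then A (y j) (x j) else 0.

Definition local_op m (j : 'I_m) (A : 'M[C]_d) : operator C d m m :=
  mkop (local_entry j A).

(* The power of X depends on the input label x, i.e. on the column. *)
Definition sum_op m (i j : 'I_m) : operator C d m m :=
  mkop (fun y x => local_entry j (shiftX ^+ x i) y x).

Inductive gate (m : nat) : Type :=
| SumGate (i j : 'I_m) of i != j
| LocalGate (j : 'I_m) (A : 'M[C]_d) of A \is unitarymx.

Definition gate_op m (g : gate m) : operator C d m m :=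
  match g with
  | SumGate i j _ => sum_op i j
  | LocalGate j A _ => local_op j A
  end.

Definition is_sum m (g : gate m) : bool :=
  if g is SumGate _ _ _ then true else false.

Definition circuit (m : nat) : Type := seq (gate m).

(* The product in written order: the last gate of the list acts first. *)
Definition circuit_op m (c : circuit m) : operator C d m m :=
  foldr (fun g U => gate_op g *m U) 1%:M c.

Definition sum_count m (c : circuit m) : nat := count (@is_sum m) c.

Definition implements n m (hnm : (n <= m)%N)
    (c : circuit m) (V : operator C d n m) : Prop :=
  forall psi : state C d n,
    circuit_op c *m tensor (subnK hnm) (ket0 (m - n)) psi = V *m psi.

End Circuits.

(* Main.v *)
Require Import Defs.
From mathcomp Require Import all_boot all_order all_algebra.
From mathcomp Require Import spectral.
From mathcomp Require Import reals complex.
From mathcomp Require Import trigo ring zify.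

(* With the embedding [|psi> |-> |0...0>|psi>] as starting point, the [d ^ n]
   columns of [V] are reached one after the other by generalized Householder
   reflections, each leaving the previous columns fixed.  A reflection along
   [w] is a conjugate, by a circuit sending [w] to a multiple of [|0...0>], of
   a diagonal operator.  Such a circuit first removes the phases of the
   amplitudes of [w] and then annihilates amplitudes by rotations of one
   qudit, uniformly controlled by the preceding ones, which are diagonal in a
   fixed basis.

   So everything reduces to phases [phi x y] of a target [y] controlled by
   [t] qudits [x], with mean zero in [y].  SUM gates turn the target into
   [y + a.x], and, [d] being prime, [phi] is a sum over [a] of functions of
   [y + a.x] (inversion of the discrete Radon transform).  A modular Gray code
   visits the [d ^ t] forms [y + a.x] with [d ^ t] SUM gates in all.  A
   reflection thus costs [(2 d + 1) (d + ... + d ^ (m - 1))] SUM gates, which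
   is within the bound even when [N_U] is replaced by 2. *)

Set Implicit Arguments.
Unset Strict Implicit.
Unset Printing Implicit Defensive.

Import Order.TTheory GRing.Theory Num.Theory.
Local Open Scope ring_scope.
Local Open Scope sesquilinear_scope.

(** * Phases *)

Section Phases.
Variable R : realType.
Local Notation C := R[i].

Definition expi (t : R) : C := Complex (cos t) (sin t).

Lemma expi0 : expi 0 = 1.
Proof. by rewrite /expi cos0 sin0. Qed.

Lemma expiD s t : expi (s + t) = expi s * expi t.
Proof.
rewrite /expi cosD sinD [in RHS]/GRing.mul /=; congr Complex.
by rewrite addrC.
Qed.

Lemma conj_expi t : (expi t)^* = expi (- t).
Proof. by rewrite /expi cosN sinN. Qed.

(** [acos] takes values in $[0,\pi]$, so the sign of the imaginary part selects the half circle;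
    this is an argument when $|z|=1$. *)
Definition arg (z : C) : R :=
  if 0 <= complex.Im z then acos (complex.Re z) else - acos (complex.Re z).

Lemma expi_arg (z : C) : z * z^* = 1 -> expi (arg z) = z.
Proof.
move=> z1; have : (complex.Re z ^+ 2 + complex.Im z ^+ 2)%:C%C = 1 :> C.
  by rewrite add_Re2_Im2 sqr_normc.
case=> /= ab1.
have b2 : complex.Im z ^+ 2 = 1 - complex.Re z ^+ 2 by rewrite -ab1 addrC addKr.
have a1 : -1 <= complex.Re z <= 1.
  by rewrite -ler_norml -(@expr_le1 _ 2) // real_normK ?num_real // -subr_ge0 -b2 sqr_ge0.
have sE : sin (acos (complex.Re z)) = `|complex.Im z|.
  by rewrite sin_acos // -b2 sqrtr_sqr.
have cE : cos (acos (complex.Re z)) = complex.Re z by apply: acosK.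
rewrite /arg /expi; case: ifPn => [hb|]; first by rewrite cE sE ger0_norm //; case: (z).
rewrite -ltNge => hb; rewrite cosN sinN cE sE ltr0_norm // opprK.
by case: (z).
Qed.

Lemma polar (z : C) : exists t, expi t * z = `|z|.
Proof.
have [->|z0] := eqVneq z 0; first by exists 0; rewrite mulr0 normr0.
have nz : `|z| != 0 by rewrite normr_eq0.
exists (arg (z^* / `|z|)); rewrite expi_arg.
  by rewrite mulrAC [z^* * z]mulrC -normCK expr2 mulfK.
rewrite rmorphM rmorphV /= ?unitfE // conjCK.
have -> : (`|z|)^* = `|z| by apply/CrealP; rewrite realE normr_ge0.
by rewrite mulrACA [z^* * z]mulrC -normCK -invfM mulfV // mulf_neq0.
Qed.

End Phases.

(** * Adjoints and unitary matrices *)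

Section Adjoint.
Variable C : numClosedFieldType.

Lemma adjM m n p (A : 'M[C]_(m, n)) (B : 'M[C]_(n, p)) :
  (A *m B)^t* = B^t* *m A^t*.
Proof. by rewrite trmx_mul map_mxM. Qed.

Lemma adj1 n : (1%:M : 'M[C]_n)^t* = 1%:M.
Proof. by rewrite trmx1 map_mx1. Qed.

Lemma unitarymxPl n (A : 'M[C]_n) : reflect (A^t* *m A = 1%:M) (A \is unitarymx).
Proof.
apply: (iffP unitarymxP) => [h|h]; exact: mulmx1C.
Qed.

End Adjoint.

(** * Uniformly controlled operators *)

Section UniformlyControlled.
Variables (R : realType) (d m : nat).
Local Notation C := R[i].
Local Notation lab := (label d m).
Implicit Types (j : 'I_m) (x y z : lab) (A B : lab -> 'M[C]_d).

Definition upd j (b : 'I_d) x : lab := [ffun i => if i == j then b else x i].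

Lemma upd_at j b x : upd j b x j = b.
Proof. by rewrite ffunE eqxx. Qed.

Lemma upd_other j b x i : i != j -> upd j b x i = x i.
Proof. by rewrite ffunE => /negPf ->. Qed.

Lemma upd_id j x : upd j (x j) x = x.
Proof. by apply/ffunP=> i; rewrite ffunE; case: eqP => // ->. Qed.

Lemma upd_upd j a b x : upd j a (upd j b x) = upd j a x.
Proof. by apply/ffunP=> i; rewrite !ffunE; case: eqP. Qed.

Definition agree j y x := [forall (k | k != j), y k == x k].

Lemma agreeP j y x : reflect (y = upd j (y j) x) (agree j y x).
Proof.
apply: (iffP forall_inP) => [h|-> k kj]; last by rewrite upd_other.
by apply/ffunP=> i; rewrite ffunE; case: eqP => [->//|/eqP/h/eqP].
Qed.

Lemma agree_upd j b x : agree j (upd j b x) x.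
Proof. by apply/agreeP; rewrite upd_at. Qed.

Lemma sum_agree (V : nmodType) j x (F : lab -> V) :
  \sum_(z | agree j z x) F z = \sum_b F (upd j b x).
Proof.
rewrite (reindex_onto (fun b => upd j b x) (fun z => z j)) /=; last first.
  by move=> z /agreeP <-.
by apply: eq_bigl => b; rewrite agree_upd upd_at eqxx.
Qed.

Lemma mkop_mul n p q (f : label d q -> label d p -> C) (g : label d p -> label d n -> C) :
  mkop f *m mkop g = mkop (fun u w => \sum_v f u v * g v w).
Proof.
apply/matrixP=> i k; rewrite !mxE [RHS](reindex _ (onW_bij _ (@enum_val_bij _))).
by apply: eq_bigr => l _; rewrite !mxE.
Qed.

Lemma eq_mkop n p (f g : label d p -> label d n -> C) :
  f =2 g -> mkop f = mkop g.
Proof. by move=> e; apply/matrixP=> i k; rewrite !mxE e. Qed.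

(* A uniformly controlled gate with target [j]; meaningful only when [A x]
   does not depend on the target coordinate [x j]. *)
Definition ucop j A : operator C d m m := mkop (fun y x => local_entry j (A x) y x).

Definition ctrl (T : Type) j (A : lab -> T) := forall x b, A (upd j b x) = A x.

Lemma eq_ucop j A B : A =1 B -> ucop j A = ucop j B.
Proof. by move=> e; apply: eq_mkop => y x; rewrite e. Qed.

(** The left factor is evaluated at an intermediate label that differs from [x] only at the target,
    so by [ctrl] its block is the one at [x]. *)
Lemma ucopM j A B : ctrl j A -> ucop j A *m ucop j B = ucop j (fun x => A x *m B x).
Proof.
move=> hA; rewrite mkop_mul; apply: eq_mkop => y x; rewrite /local_entry.
rewrite -/(agree j y x) (bigID (fun z => agree j z x)) /= addrC big1 ?add0r; last first.
  by move=> z nz; rewrite -/(agree j z x) (negPf nz) mulr0.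
rewrite sum_agree; case: ifPn => [yx|nyx].
  rewrite mxE; apply: eq_bigr => b _.
  rewrite -/(agree j y (upd j b x)) -/(agree j (upd j b x) x) agree_upd hA upd_at.
  case: ifPn => // /negP[]; apply/agreeP; rewrite upd_upd; exact/agreeP.
apply: big1 => b _; rewrite -/(agree j y (upd j b x)).
case: ifPn; rewrite ?mul0r // => /agreeP yb.
by case/negP: nyx; apply/agreeP; rewrite {1}yb upd_upd.
Qed.

Lemma ucop1 j : ucop j (fun=> 1%:M) = 1%:M.
Proof.
apply/matrixP=> i k; rewrite !mxE /local_entry -/(agree _ _ _) mxE.
rewrite -(inj_eq enum_val_inj); set y := enum_val i; set x := enum_val k.
case: ifPn => [/agreeP e|n].
  congr (_%:R); congr nat_of_bool; apply/eqP/eqP => [e'|-> //].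
  by rewrite e e' upd_id.
case: eqP => // e; case/negP: n; apply/agreeP; by rewrite e upd_id.
Qed.

Lemma ucop_adj j A : ctrl j A -> (ucop j A)^t* = ucop j (fun x => (A x)^t*).
Proof.
move=> hA; apply/matrixP=> i k; rewrite !mxE /local_entry -!/(agree _ _ _).
set y := enum_val i; set x := enum_val k.
case: ifPn => [/agreeP e|n]; case: ifPn => [/agreeP e'|n'].
- by rewrite !mxE e hA upd_at.
- by case/negP: n'; apply/agreeP; rewrite {1}e upd_upd upd_id.
- by case/negP: n; apply/agreeP; rewrite {1}e' upd_upd upd_id.
- by rewrite rmorph0.
Qed.

Lemma amp_ucop j A (v : state C d m) y :
  ctrl j A -> amp (ucop j A *m v) y = \sum_b A y (y j) b * amp v (upd j b y).
Proof.
move=> hA; rewrite /amp mxE (reindex _ (onW_bij _ (@enum_rank_bij _))) /=.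
under eq_bigr do rewrite mxE !enum_rankK /local_entry -/(agree _ _ _).
rewrite (bigID (fun z => agree j z y)) /= addrC big1 ?add0r; last first.
  move=> z nz; case: ifPn; rewrite ?mul0r // => /agreeP yb.
  by case/negP: nz; apply/agreeP; rewrite yb upd_upd upd_id.
rewrite sum_agree; apply: eq_bigr => b _; rewrite hA upd_at.
case: ifPn => // /negP[]; apply/agreeP; by rewrite upd_upd upd_id.
Qed.

End UniformlyControlled.

(** * Phases of a target controlled by other qudits *)

Section Radon.
Variable p : nat.
Hypothesis p_prime : prime p.+2.
Local Notation Z := 'I_p.+2.

Lemma ord_unit (u : Z) : u != 0 -> u \is a GRing.unit.
Proof.
move=> u0; rewrite -[u]natr_Zp (@unitZpE p.+2) // prime_coprime //.
by rewrite gtnNdvd ?lt0n.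
Qed.

Lemma sum_affine (V : nmodType) (F : Z -> V) (u y : Z) :
  u != 0 -> \sum_k F (y + k * u) = \sum_b F b.
Proof.
move=> /ord_unit hu; rewrite [RHS](reindex (fun k : Z => y + k * u)) //.
exists (fun b => (b - y) / u) => b _; first by rewrite addrC addKr mulrK.
by rewrite divrK // addrC subrK.
Qed.

Variable K : numFieldType.

(** For each slope [k] the inner sum runs along a line through $(x,y)$. The point itself lies on all
    $d$ lines; for $a\ne x$ these lines meet column [a] once at each height, and the column sums to
    zero. *)
Lemma radon_inversion (F : Z -> Z -> K) (x y : Z) :
  (forall a, \sum_b F a b = 0) ->
  F x y = \sum_k (p.+2%:R)^-1 * \sum_a F a (y + k * x - k * a).
Proof.
move=> F0; rewrite -mulr_sumr exchange_big /= (bigD1 x) //= [X in _ + X]big1 ?addr0.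
  under eq_bigr do rewrite addrK.
  by rewrite sumr_const card_ord -[F x y *+ _]mulr_natl mulKf // pnatr_eq0.
move=> a ax; have xa : x - a != 0 by rewrite subr_eq0 eq_sym.
transitivity (\sum_k F a (y + k * (x - a))); last by rewrite sum_affine.
by apply: eq_bigr => k _; rewrite mulrBr addrA.
Qed.

End Radon.

(** * Circuits with a bound on their SUM gates *)

Section Implementable.
Variables (R : realType) (d m : nat).
Local Notation C := R[i].

Definition impl (k : nat) (U : operator C d m m) : Prop :=
  exists2 c : circuit R d m, circuit_op c = U & (sum_count c <= k)%N.

Lemma impl_leq k l U : (k <= l)%N -> impl k U -> impl l U.
Proof. by move=> kl [c cU ck]; exists c => //; apply: leq_trans kl. Qed.

Lemma impl_eq k U W : U = W -> impl k W -> impl k U.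
Proof. by move=> ->. Qed.

Lemma impl1 : impl 0 1%:M.
Proof. by exists [::]. Qed.

Lemma implM k l U W : impl k U -> impl l W -> impl (k + l) (U *m W).
Proof.
move=> [c <- ck] [e <- el]; exists (c ++ e).
  by elim: c {ck} => [|g c IH] /=; rewrite ?mul1mx // IH mulmxA.
by rewrite /sum_count count_cat leq_add.
Qed.

Lemma impl_local (j : 'I_m) (A : 'M[C]_d) :
  A \is unitarymx -> impl 0 (ucop j (fun=> A)).
Proof. by move=> hA; exists [:: LocalGate j hA] => //=; rewrite mulmx1. Qed.

Lemma impl_sum (i j : 'I_m) : i != j -> impl 1 (ucop j (fun x => shiftX R d ^+ x i)).
Proof. by move=> ij; exists [:: SumGate R d ij] => //=; rewrite mulmx1. Qed.

End Implementable.

(** * Shift, inversion and phase matrices of one qudit *)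

Section Shift.
Variables (R : realType) (p : nat).
Local Notation C := R[i].
Local Notation d := p.+2.

Definition shift (b : 'I_d) : 'M[C]_d := \matrix_(y, a) (y == a + b)%:R.

Definition flip : 'M[C]_d := \matrix_(y, a) (y == - a)%:R.

Definition phase_mx (f : 'I_d -> R) : 'M[C]_d := diag_mx (\row_b expi (f b)).

Lemma shiftM a b : shift a *m shift b = shift (a + b).
Proof.
apply/matrixP=> y x; rewrite !mxE (bigD1 (x + b)) //= !mxE eqxx mulr1 big1 ?addr0.
  by rewrite -addrA [b + a]addrC.
by move=> z /negPf zx; rewrite !mxE zx mulr0.
Qed.

Lemma shift0 : shift 0 = 1%:M.
Proof. by apply/matrixP=> y x; rewrite !mxE addr0. Qed.

Lemma shiftXE (b : 'I_d) : shiftX R d ^+ b = shift b.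
Proof.
have X1 : shiftX R d = shift 1.
  apply/matrixP=> y x; rewrite !mxE; congr (_ == _)%:R.
  by rewrite -(add_Zp_1 (p := d)).
rewrite -{2}[b]natr_Zp; elim: (b : nat) => [|n IH]; first by rewrite shift0.
by rewrite exprS IH X1 -mulmxE shiftM -natr1 addrC.
Qed.

Lemma shift_adj b : (shift b)^t* = shift (- b).
Proof.
apply/matrixP=> y x; rewrite !mxE rmorph_nat; congr (_%:R).
by rewrite [in RHS]eq_sym subr_eq.
Qed.

Lemma flip_adj : flip^t* = flip.
Proof.
by apply/matrixP=> y x; rewrite !mxE rmorph_nat [in LHS]eq_sym eqr_oppLR.
Qed.

Lemma flipM n (A : 'M_(d, n)) : flip *m A = \matrix_(y, x) A (- y) x.
Proof.
apply/matrixP=> y x; rewrite !mxE (bigD1 (- y)) //= !mxE opprK eqxx mul1r big1 ?addr0 //.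
move=> z zy; rewrite !mxE; case: eqP => [e|]; last by rewrite mul0r.
by rewrite e opprK eqxx in zy.
Qed.

Lemma flip_unitary : flip \is unitarymx.
Proof.
apply/unitarymxP; rewrite flip_adj flipM; apply/matrixP=> y x.
by rewrite !mxE eqr_opp.
Qed.

Lemma flip_shift b : flip *m (shift b *m flip) = shift (- b).
Proof.
rewrite flipM; apply/matrixP=> y x; rewrite !mxE (bigD1 (- x)) //= !mxE eqxx mulr1.
rewrite big1 ?addr0; last by move=> z /negPf zx; rewrite !mxE zx mulr0.
by rewrite eqr_oppLR opprD opprK.
Qed.

Lemma eq_phase_mx f g : f =1 g -> phase_mx f = phase_mx g.
Proof. by move=> e; congr diag_mx; apply/rowP=> b; rewrite !mxE e. Qed.

Lemma phase_mxM f g : phase_mx f *m phase_mx g = phase_mx (fun b => f b + g b).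
Proof.
by rewrite mulmx_diag; congr diag_mx; apply/rowP=> b; rewrite !mxE expiD.
Qed.

Lemma phase_mx0 : phase_mx (fun=> 0) = 1%:M.
Proof. by apply/matrixP=> y x; rewrite !mxE expi0. Qed.

Lemma phase_mx_adj f : (phase_mx f)^t* = phase_mx (fun b => - f b).
Proof.
apply/matrixP=> y x; rewrite !mxE eq_sym; case: eqP => [->|_] /=.
  by rewrite !mulr1n conj_expi.
by rewrite !mulr0n rmorph0.
Qed.

Lemma phase_mx_unitary f : phase_mx f \is unitarymx.
Proof.
apply/unitarymxP; rewrite phase_mx_adj phase_mxM -phase_mx0.
by apply: eq_phase_mx => b; apply: subrr.
Qed.

Lemma phase_mx_shift g b : phase_mx g *m shift b = shift b *m phase_mx (fun z => g (z + b)).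
Proof.
rewrite mul_diag_mx mul_mx_diag; apply/matrixP=> y x; rewrite !mxE.
by case: eqP => [->|_]; rewrite ?mulr0 ?mul0r ?mulr1 ?mul1r.
Qed.

(** Moving all shifts to the left makes the phase of round [k] see a target already translated [k]
    times by [s]; round 0 is rightmost, hence acts first. *)
Lemma shift_phase_mx_iter (s : 'I_d) (g : nat -> 'I_d -> R) n :
  iteri n (fun k M => shift s *m phase_mx (g k) *m M) 1%:M =
  shift (n%:R * s) *m phase_mx (fun b => \sum_(k < n) g k (b + k%:R * s)).
Proof.
elim: n => [|n IH] /=.
  rewrite mul0r shift0 mul1mx -phase_mx0; apply: eq_phase_mx => b; by rewrite big_ord0.
rewrite IH -!mulmxA [phase_mx _ *m (_ *m _)]mulmxA phase_mx_shift -mulmxA.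
rewrite phase_mxM mulmxA shiftM.
rewrite -natr1 mulrDl mul1r addrC; congr (_ *m _); apply: eq_phase_mx => b.
by rewrite big_ord_recr /= addrC.
Qed.

End Shift.

Lemma ucop_unitary (R : realType) d m (j : 'I_m) (A : label d m -> 'M[R[i]]_d) :
  ctrl j A -> (forall x, A x \is unitarymx) -> ucop j A \is unitarymx.
Proof.
move=> hA uA; apply/unitarymxP; rewrite ucop_adj // ucopM // -(ucop1 R d j).
by apply: eq_ucop => x; apply/unitarymxP.
Qed.

(** * Gray code synthesis of controlled phases *)

Section Synthesis.
Variables (R : realType) (p m : nat).
Local Notation C := R[i].
Local Notation d := p.+2.
Local Notation lab := (label d m).
Local Notation impl := (@impl R d m).
Implicit Types x y : lab.

Lemma shift_unitary (b : 'I_d) : shift R b \is unitarymx.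
Proof. by apply/unitarymxP; rewrite shift_adj shiftM subrr shift0. Qed.

Lemma ctrl_coord (T : Type) (i j : 'I_m) (f : 'I_d -> T) :
  i != j -> ctrl j (fun x : lab => f (x i)).
Proof. by move=> ij x b; rewrite upd_other. Qed.

Lemma sum_opE (i j : 'I_m) : sum_op R d i j = ucop j (fun x : lab => shift R (x i)).
Proof. by apply: eq_mkop => y x; rewrite shiftXE. Qed.

Lemma gate_unitary (g : gate R d m) : gate_op g \is unitarymx.
Proof.
case: g => [i j ij|j A hA] /=; last exact: ucop_unitary.
rewrite sum_opE; apply: ucop_unitary => [|x]; last exact: shift_unitary.
exact: ctrl_coord.
Qed.

Lemma impl_unitary k U : impl k U -> U \is unitarymx.
Proof.
case=> c <- _; elim: c => [|g c IH] /=; first by apply/unitarymxP; rewrite adj1 mulmx1.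
by rewrite mul_unitarymx ?gate_unitary.
Qed.

(* The inversion [y |-> - y] on the target conjugates [X] into its inverse. *)
Lemma impl_sum_adj (i j : 'I_m) :
  i != j -> impl 1 (ucop j (fun x => shift R (- x i))).
Proof.
move=> ij; have F := impl_local j (flip_unitary R p).
have := implM F (implM (impl_sum R d ij) F).
rewrite ucopM; last by apply: (ctrl_coord (fun b => shiftX R d ^+ b)).
rewrite ucopM //; congr impl; apply: eq_ucop => x.
by rewrite shiftXE flip_shift.
Qed.

(** The circuit is reversed gate by gate; an inverse SUM gate still costs one SUM gate, by
    conjugation with [flip]. *)
Lemma impl_adj k U : impl k U -> impl k (U^t*).
Proof.
case=> c <- ck; apply: impl_leq ck _.
elim: c => [|g c IH] /=; first by rewrite adj1; apply: impl1.
rewrite adjM /sum_count /= addnC; apply: implM IH _.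
case: g => [i j ij|j A hA] /=.
  rewrite sum_opE ucop_adj; last exact: ctrl_coord.
  apply: impl_eq (impl_sum_adj ij).
  by apply: eq_ucop => x; rewrite shift_adj.
by rewrite [X in impl _ X]ucop_adj //; apply: impl_local; rewrite trmxC_unitary.
Qed.

Definition dep_below (T : Type) (t : nat) (f : lab -> T) :=
  forall x y : lab, (forall i : 'I_m, (i < t)%N -> x i = y i) -> f x = f y.

Lemma dep_leq (T : Type) s t (f : lab -> T) : (s <= t)%N -> dep_below s f -> dep_below t f.
Proof. by move=> st h x y e; apply: h => i it; apply: e; apply: leq_trans st. Qed.

Lemma dep_ctrl (T : Type) t (f : lab -> T) (j : 'I_m) : (t <= j)%N -> dep_below t f -> ctrl j f.
Proof.
move=> tj h x b; apply: h => i it; rewrite upd_other //.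
by apply: contraTneq it => ->; rewrite -leqNgt.
Qed.

Definition phases_dep t (phi : lab -> 'I_d -> R) := forall b, dep_below t (phi^~ b).

Lemma phases_ctrl t (phi : lab -> 'I_d -> R) (j : 'I_m) :
  (t <= j)%N -> phases_dep t phi -> ctrl j (fun x => phase_mx (phi x)).
Proof. by move=> tj h x b; apply: eq_phase_mx => a; apply: dep_ctrl (h a) _ _. Qed.

Hypothesis d_prime : prime d.

(* An open walk through all [d ^ t] linear forms [y + a.x] in the first [t]
   controls, made of [d ^ t - 1] SUM gates, ends at the form
   [y - beta x]; closing it takes one more SUM gate (none if [t = 0]). *)
Lemma gray_walk (j : 'I_m) t : (t <= j)%N ->
  exists beta : lab -> 'I_d,
  [/\ dep_below t beta,
      impl (t > 0)%N (ucop j (fun x => shift R (beta x))) &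
      forall phi, phases_dep t phi -> (forall x, \sum_b phi x b = 0) ->
        impl (d ^ t - 1)%N (ucop j (fun x => shift R (- beta x) *m phase_mx (phi x)))].
Proof.
elim: t => [|t IH] tj.
  exists (fun=> 0); split=> //.
    apply: impl_eq (impl1 R d m); rewrite -(ucop1 R d j).
    by apply: eq_ucop => x; rewrite shift0.
  (* Without controls [phi] does not depend on the label, so any [x0] yields the local gate. *)
  move=> phi hphi _; have x0 : lab := [ffun=> 0].
  apply: impl_eq (impl_local j (phase_mx_unitary (phi x0))).
  apply: eq_ucop => x; rewrite oppr0 shift0 mul1mx; apply: eq_phase_mx => b.
  by apply: hphi.
have [beta [hb _ himpl]] := IH (ltnW tj).
pose it : 'I_m := Ordinal (ltn_trans tj (ltn_ord j)).
have itj : it != j by rewrite neq_ltn tj.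
have hit : dep_below t.+1 (fun x : lab => x it) by move=> x y e; apply: e.
have hs : dep_below t.+1 (fun x => x it - beta x).
  by move=> x y e; rewrite (hit _ _ e) (dep_leq (leqnSn t) hb e).
(* The longer walk ends at $y-x_t$, so one SUM gate from the new control [it] closes it. *)
exists (fun x => x it); split=> //.
  rewrite -sum_opE.
  by exists [:: SumGate R d itj] => //=; rewrite mulmx1.
move=> phi hphi phi0.
(* The slope-[k] term of the Radon inversion in coordinate [it]. The summand [k%:R * beta x]
   compensates the drift of the target caused by [k] inner walks; overwriting [it] by [a] leaves
   only the first [t] controls. *)
pose g (k : nat) x (z : 'I_d) : R :=
  (d%:R)^-1 * \sum_a phi (upd it a x) (z + k%:R * beta x - k%:R * a).
have hg k : phases_dep t (g k).
  move=> b x y e; rewrite /g (hb _ _ e); congr (_ * _); apply: eq_bigr => a _.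
  apply: hphi => i; rewrite ltnS => il; rewrite !ffunE; case: eqP => // /eqP ni.
  by apply: e; rewrite ltn_neqAle il andbT; apply: contraNneq ni => h; apply/eqP/val_inj.
have g0 k x : \sum_b g k x b = 0.
  rewrite -mulr_sumr exchange_big /= big1 ?mulr0 // => a _.
  rewrite -[RHS](phi0 (upd it a x)).
  rewrite [RHS](reindex_inj (addIr (k%:R * beta x - k%:R * a))).
  by apply: eq_bigr => b _; rewrite addrA.
have gE x (y : 'I_d) : \sum_(k < d) g k x (y + k%:R * (x it - beta x)) = phi x y.
  have phi_upd0 a : \sum_b phi (upd it a x) b = 0 by apply: phi0.
  rewrite -[in RHS](upd_id it x) (radon_inversion d_prime (x it) y phi_upd0).
  apply: eq_bigr => k _; rewrite /g natr_Zp; congr (_ * _); apply: eq_bigr => a _.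
  by congr (phi _ (_ - _)); rewrite mulrBr addrA subrK.
(* A round is an inner walk with phases [g k] and then one SUM gate from [it]: a net translation by
   $x_t-\beta(x)$. *)
pose M n x := iteri n (fun k M => shift R (x it - beta x) *m phase_mx (g k x) *m M) 1%:M.
have ctM n : ctrl j (M n).
  move=> x b; elim: n => [//|n IHn]; rewrite /M /= -/(M n _) -/(M n _) IHn.
  congr (shift R _ *m _ *m _); first exact: dep_ctrl hs _ _.
  by apply: (phases_ctrl (ltnW tj) (hg n)).
have ctQ n : ctrl j (fun x => shift R (- beta x) *m phase_mx (g n x)).
  move=> x b; congr (shift R (- _) *m _); first exact: dep_ctrl (ltnW tj) hb _ _.
  exact: (phases_ctrl (ltnW tj) (hg n)).
have iQ n : impl (d ^ t - 1)%N (ucop j (fun x => shift R (- beta x) *m phase_mx (g n x))).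
  exact: himpl.
have dt : (0 < d ^ t)%N by rewrite expn_gt0.
have iM n : impl (n * d ^ t)%N (ucop j (M n)).
  elim: n => [|n IHn]; first by rewrite [ucop _ _]ucop1; apply: impl1.
  have := implM (implM (impl_sum R d itj) (iQ n)) IHn.
  rewrite subnKC // -mulSn ucopM; last exact: (ctrl_coord (fun b => shiftX R d ^+ b)).
  rewrite ucopM; last by move=> x b; rewrite upd_other // ctQ.
  congr impl; apply: eq_ucop => x; rewrite shiftXE mulmxA shiftM.
  by rewrite /M /= -mulmxA.
(* After [p.+1] full rounds, the last inner walk goes without its SUM gate, which leaves the target
   at $y-x_t$. *)
have := implM (iQ p.+1) (iM p.+1); rewrite ucopM //.
have -> : (d ^ t - 1 + p.+1 * d ^ t = d ^ t.+1 - 1)%N.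
  by rewrite addnC addnBA // -mulSnr expnS.
congr impl; apply: eq_ucop => x.
(* Over [d] rounds the total translation is a multiple of [d], hence zero. *)
have -> : phase_mx (phi x) = M d x.
  rewrite /M shift_phase_mx_iter; have -> : d%:R = 0 :> 'I_d by apply: (@pchar_Zp d).
  by rewrite mul0r shift0 mul1mx; apply: eq_phase_mx => b; rewrite gE.
rewrite /M [in RHS]iteriS -/(M _ _) !mulmxA shiftM.
by rewrite addrA addNr add0r.
Qed.

(** For [j = 0] there are no controls and the gate is local, hence free. *)
Definition uc_cost (j : nat) : nat := ((0 < j) * d ^ j)%N.

Lemma impl_uc_phases (j : 'I_m) (phi : lab -> 'I_d -> R) :
  phases_dep j phi -> (forall x, \sum_b phi x b = 0) ->
  impl (uc_cost j) (ucop j (fun x => phase_mx (phi x))).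
Proof.
move=> hphi phi0; have [beta [hb hE hD]] := gray_walk (leqnn j).
have -> : ucop j (fun x => phase_mx (phi x)) = ucop j (fun x => shift R (beta x)) *m
    ucop j (fun x => shift R (- beta x) *m phase_mx (phi x)).
  rewrite ucopM; last by move=> x b; rewrite (dep_ctrl _ hb).
  by apply: eq_ucop => x; rewrite mulmxA shiftM subrr shift0 mul1mx.
apply: impl_leq (implM hE (hD phi hphi phi0)); rewrite /uc_cost.
by case: (j : nat) => [//|k] /=; rewrite mul1n subnKC // expn_gt0.
Qed.

End Synthesis.

(** * Diagonal operators and rotations *)

Section Diagonal.
Variables (R : realType) (p m : nat).
Local Notation C := R[i].
Local Notation d := p.+2.
Local Notation lab := (label d m).
Local Notation impl := (@impl R d m).
Implicit Types x y : lab.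

Definition diagop (theta : lab -> R) : operator C d m m :=
  mkop (fun y x => expi (theta x) *+ (y == x)).

(** Any qudit may serve as target; overwriting its coordinate makes the phases independent of [x j],
    as [ctrl] requires. *)
Lemma diagop_ucop (j : 'I_m) theta :
  diagop theta = ucop j (fun x => phase_mx (fun b => theta (upd j b x))).
Proof.
apply: eq_mkop => y x; rewrite /local_entry -/(agree j y x) !mxE.
case: ifPn => [/agreeP e|n].
  rewrite -e; have [e'|ne] := eqVneq (y j) (x j).
    have -> : y = x by rewrite e e' upd_id.
    by rewrite eqxx.
  have /negPf -> // : y != x by apply: contraNneq ne => ->.
by case: eqP n => // ->; case/negP; apply/agreeP; rewrite upd_id.
Qed.

Lemma diagopD (j : 'I_m) s t : diagop (fun x => s x + t x) = diagop s *m diagop t.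
Proof.
rewrite !(diagop_ucop j) ucopM.
  by apply: eq_ucop => x; rewrite phase_mxM; apply: eq_phase_mx.
by move=> x b; apply: eq_phase_mx => a; rewrite upd_upd.
Qed.

Lemma amp_diagop theta (v : state C d m) y :
  amp (diagop theta *m v) y = expi (theta y) * amp v y.
Proof.
rewrite /amp mxE (reindex _ (onW_bij _ (@enum_rank_bij _))) /= (bigD1 y) //=.
rewrite mxE !enum_rankK eqxx mulr1n big1 ?addr0 // => x xy.
by rewrite mxE !enum_rankK eq_sym (negPf xy) mulr0n mul0r.
Qed.

Hypothesis d_prime : prime d.

Definition diag_cost : nat := (\sum_(j < m) uc_cost p j)%N.

(** The last qudit on which [theta] depends is peeled off: the average over it depends on fewer
    qudits, and the remainder, of mean zero, is a controlled phase on it. *)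
Lemma impl_diagop theta : (0 < m)%N -> impl diag_cost (diagop theta).
Proof.
move=> m0; suff H t : (t <= m)%N -> forall f, dep_below t f ->
    impl (\sum_(j < t) uc_cost p j)%N (diagop f).
  by apply: H => // x y e; congr theta; apply/ffunP => i; apply: e.
elim: t => [|t IH] tm {}theta ht.
  (* Only a global phase is left, a scalar local gate on qudit 0. *)
  rewrite big_ord0 (diagop_ucop (Ordinal m0)); have x0 : lab := [ffun=> 0].
  apply: impl_eq (impl_local (Ordinal m0) (phase_mx_unitary (fun=> theta x0))).
  by apply: eq_ucop => x; apply: eq_phase_mx => b; apply: ht.
pose j : 'I_m := Ordinal tm.
pose avg x : R := d%:R^-1 * \sum_b theta (upd j b x).
have upd_dep b x y : (forall i : 'I_m, (i < t)%N -> x i = y i) ->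
    theta (upd j b x) = theta (upd j b y).
  move=> e; apply: ht => i; rewrite ltnS => it; rewrite !ffunE.
  case: eqP => // /eqP ni; apply: e; rewrite ltn_neqAle it andbT.
  by apply: contraNneq ni => h; apply/eqP/val_inj.
have havg : dep_below t avg.
  by move=> x y e; congr (_ * _); apply: eq_bigr => b _; apply: upd_dep.
have avgj b x : avg (upd j b x) = avg x by apply: (dep_ctrl (j := j) _ havg).
have -> : diagop theta = diagop (fun x => avg x + (theta x - avg x)).
  by apply: eq_mkop => y x; rewrite addrC subrK.
rewrite (diagopD j) big_ord_recr /=; apply: implM; first exact: IH (ltnW tm) _ _.
rewrite (diagop_ucop j); apply: (@impl_uc_phases _ _ _ d_prime j) => [b x y e|x].
  by rewrite !avgj (upd_dep _ _ _ e) (havg _ _ e).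
under eq_bigr do rewrite avgj.
rewrite sumrB sumr_const card_ord -[avg x *+ _]mulr_natl mulrA mulfV ?mul1r ?subrr //.
by rewrite pnatr_eq0.
Qed.

End Diagonal.

Section Rotation.
Variables (R : realType) (p : nat) (k : 'I_p.+2).
Local Notation C := R[i].
Local Notation d := p.+2.
Hypothesis k0 : k != 0.

(** For $e=e^{it}$ the coefficients are $\cos t$ and $\sin t$; written in [e], all identities are
    algebraic over [C]. *)
Definition rot (e : C) : 'M[C]_d := \matrix_(b, a)
  (if b == 0 then (e + e^*) / 2 *+ (a == 0) + (e - e^*) / (2 * 'i) *+ (a == k)
   else if b == k then (e + e^*) / 2 *+ (a == k) - (e - e^*) / (2 * 'i) *+ (a == 0)
   else (b == a)%:R).

Lemma rot1 : rot 1 = 1%:M.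
Proof.
have two : (1 + 1) / 2 = 1 :> C by rewrite -(natrD _ 1 1) mulfV ?pnatr_eq0.
apply/matrixP=> b a; rewrite !mxE conjC1 subrr mul0r two !mul0rn addr0 subr0.
case: eqP => [->|_]; first by rewrite eq_sym.
by case: eqP => [->|//]; rewrite eq_sym.
Qed.

(* The eigenvectors of all rotations in the plane spanned by |0> and |k>. *)
Definition rot_basis : 'M[C]_d := \matrix_(c, a)
  (if c == 0 then (sqrtC 2)^-1 * ((a == 0)%:R - 'i *+ (a == k))
   else if c == k then (sqrtC 2)^-1 * ((a == 0)%:R + 'i *+ (a == k))
   else (c == a)%:R).

Definition rot_phases (t : R) (b : 'I_d) : R :=
  if b == 0 then t else if b == k then - t else 0.

Lemma rot_phases_sum t : \sum_b rot_phases t b = 0.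
Proof.
rewrite (bigD1 0) //= (bigD1 k) //= big1; last first.
  by move=> b /andP[b0 bk]; rewrite /rot_phases (negPf b0) (negPf bk).
by rewrite /rot_phases eqxx (negPf k0) eqxx addr0 subrr.
Qed.

(** The eigenbasis does not depend on the angle and the eigenphases $t,-t,0,\dots$ sum to zero, so a
    controlled rotation is a controlled phase up to free local gates. *)
Lemma rotE t : rot_basis^t* *m (phase_mx (rot_phases t) *m rot_basis) = rot (expi t).
Proof.
have i2 : 'i * 'i = -1 :> C by rewrite -expr2 sqrCi.
have s2 : (sqrtC 2 : C)^-1 * (sqrtC 2)^-1 = 2^-1 by rewrite -invfM -expr2 sqrtCK.
have sc : ((sqrtC 2 : C)^-1)^* = (sqrtC 2)^-1.
  by apply/CrealP; rewrite rpredV realE sqrtC_ge0 ler0n.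
have n2 : (2 : C) != 0 by rewrite pnatr_eq0.
have ni : 'i != 0 :> C by rewrite neq0Ci.
have divi (z : C) : z / (2 * 'i) = - (z * 'i / 2).
  apply: (mulIf (mulf_neq0 n2 ni)); rewrite divfK ?mulf_neq0 //.
  by rewrite mulNr mulrA divfK // -mulrA i2 mulrN1 opprK.
have cn (n : nat) : (n%:R : C)^* = n%:R by rewrite rmorph_nat.
have ci (n : nat) : ('i *+ n : C)^* = - 'i *+ n by rewrite rmorphMn /= conjCi.
apply/matrixP=> b a; rewrite mul_diag_mx !mxE (bigD1 0) //= (bigD1 k) //= !mxE.
rewrite /rot_phases eqxx (negPf k0) eqxx.
rewrite !rmorphM !(rmorphB, rmorphD) /= !cn !ci sc -conj_expi !divi.
set e := expi t; set f := e^*; set s := (sqrtC 2)^-1.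
have sm (x y z : C) : s * x * (z * (s * y)) = z * (x * y) / 2.
  by rewrite mulrCA mulrACA s2 mulrA mulrAC.
rewrite !sm.
rewrite [X in _ + (_ + X)](_ : _ =
    if (b == 0) || (b == k) then 0 else (b == a)%:R); last first.
  under eq_bigr => i /andP[i0 ik].
    rewrite !mxE /rot_phases (negPf i0) (negPf ik) expi0 mul1r rmorph_nat -natrM mulnb; over.
  case: ifPn => [b0k|nb0k].
    rewrite big1 // => i /andP[i0 ik]; case: (i =P b) => // ib.
    by rewrite -ib (negPf i0) (negPf ik) in b0k.
  rewrite negb_or in nb0k; rewrite (bigD1 b) //= eqxx big1 ?addr0 //.
  by move=> i /andP[_ /negPf ->].
clearbody e f s; have k0' : (0 == k) = false by rewrite eq_sym (negPf k0).
have [->|b0] := eqVneq b 0.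
  rewrite k0' /=; have [->|a0] := eqVneq a 0.
    by rewrite k0' /= !mulr0n !mulr1n; field.
  by case: (a == k); rewrite /= ?(mulr0n, mulr1n); field.
have [bk|bk] := eqVneq b k; last first.
  by rewrite /= !mulr0n; ring.
have [->|a0] := eqVneq a 0.
  by rewrite k0' /= !mulr0n !mulr1n; field.
by case: (a == k); rewrite /= ?(mulr0n, mulr1n); field: i2.
Qed.

End Rotation.

(** At angle zero the diagonalised rotation is the identity. *)
Lemma rot_basis_unitary (R : realType) p (k : 'I_p.+2) :
  k != 0 -> rot_basis R k \is unitarymx.
Proof.
move=> k0; apply/unitarymxPl; rewrite -(rot1 R k) -expi0 -(rotE k0).
have -> : phase_mx (rot_phases k 0) = 1%:M :> 'M[R[i]]_p.+2; last by rewrite mul1mx.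
rewrite -phase_mx0; apply: eq_phase_mx => b; rewrite /rot_phases oppr0.
by case: ifP => // _; case: ifP.
Qed.

(** * State preparation *)

Section Preparation.
Variables (R : realType) (p m : nat).
Local Notation C := R[i].
Local Notation d := p.+2.
Local Notation lab := (label d m).
Local Notation impl := (@impl R d m).
Implicit Types x y : lab.
Hypothesis d_prime : prime d.

Lemma impl_rot (j : 'I_m) (k : 'I_d) (t : lab -> R) : k != 0 -> dep_below j t ->
  impl (uc_cost p j) (ucop j (fun x => rot k (expi (t x)))).
Proof.
move=> k0 ht; have W := impl_local j (rot_basis_unitary R k0).
have hp : phases_dep j (fun x => rot_phases k (t x)).
  by move=> b x y e; rewrite (ht _ _ e).
have := implM (impl_adj W)
  (implM (impl_uc_phases d_prime hp (fun x => rot_phases_sum k0 _)) W).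
rewrite addn0 add0n ucop_adj // ucopM; last by apply: phases_ctrl hp.
rewrite ucopM //; apply: impl_eq; apply: eq_ucop => x.
by rewrite rotE.
Qed.

(* For nonnegative reals [a, b]: the unit complex number such that the
   rotation by its argument maps [(a, b)] to [(sqrt (a^2 + b^2), 0)]. *)
Definition givens_phase (a b : C) : C :=
  if a ^+ 2 + b ^+ 2 == 0 then 1 else (a + 'i * b) / sqrtC (a ^+ 2 + b ^+ 2).

Lemma givens_phaseP (a b : C) (e := givens_phase a b) : 0 <= a -> 0 <= b ->
  [/\ e * e^* = 1,
      (e + e^*) / 2 * a + (e - e^*) / (2 * 'i) * b = sqrtC (a ^+ 2 + b ^+ 2) &
      (e + e^*) / 2 * b - (e - e^*) / (2 * 'i) * a = 0].
Proof.
move=> a0 b0; have i2 : 'i * 'i = -1 :> C by rewrite -expr2 sqrCi.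
have n2 : (2 : C) != 0 by rewrite pnatr_eq0.
have ni : 'i != 0 :> C by rewrite neq0Ci.
rewrite /e /givens_phase; case: ifPn => [/eqP ab0|ab].
  (* Both squares are nonnegative, so $a=b=0$ and the default phase 1, the trivial rotation,
     serves. *)
  have a2 : a ^+ 2 = 0.
    by apply/eqP; move/eqP: ab0; rewrite paddr_eq0 ?exprn_ge0 // => /andP[].
  move: ab0; rewrite a2 add0r => /eqP; rewrite sqrf_eq0 => /eqP ->.
  move/eqP: a2; rewrite sqrf_eq0 => /eqP ->.
  by rewrite conjC1 subrr expr0n /= sqrtC0 !mulr0 mulr1 addr0 subr0.
set r := sqrtC _; have rr : r ^+ 2 = a ^+ 2 + b ^+ 2 by rewrite sqrtCK.
have r0 : r != 0 by rewrite sqrtC_eq0.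
have ca : a^* = a by apply/CrealP/ger0_real.
have cb : b^* = b by apply/CrealP/ger0_real.
have cr : r^* = r.
  by apply/CrealP/ger0_real; rewrite sqrtC_ge0 addr_ge0 ?exprn_ge0.
rewrite rmorphM rmorphV ?unitfE //= rmorphD rmorphM /= conjCi ca cb cr.
clearbody r; have hr : r * r = a * a + b * b by rewrite -!expr2.
split.
- rewrite mulrACA -invfM hr -expr2 -!expr2 -[RHS](mulfV ab); congr (_ / _).
  by ring: i2.
- have -> : (a + 'i * b) / r + (a + - 'i * b) / r = 2 * (a / r) by field.
  have -> : (a + 'i * b) / r - (a + - 'i * b) / r = (2 * 'i) * (b / r) by field.
  apply: (mulIf r0); rewrite hr; field.
  by rewrite r0 ni.
- by field; rewrite ni r0.
Qed.

Definition below (j : nat) x : lab := [ffun i : 'I_m => if (i < j)%N then x i else 0].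

(** A rotation controlled by the qudits before [j] merges the amplitude of level [k] into level 0 as
    a root of a sum of squares, hence nonnegative. The other levels are untouched, so earlier
    eliminations survive. *)
Lemma sweep_level (j : 'I_m) (k : 'I_d) (v : state C d m) :
  k != 0 -> (forall y, 0 <= amp v y) ->
  (forall y (i : 'I_m), (j < i)%N -> y i != 0 -> amp v y = 0) ->
  exists U, [/\ impl (uc_cost p j) U, forall y, 0 <= amp (U *m v) y,
    forall y (i : 'I_m), (j < i)%N -> y i != 0 -> amp (U *m v) y = 0,
    forall y, y j = k -> amp (U *m v) y = 0 &
    forall y, y j != 0 -> y j != k -> amp (U *m v) y = amp v y].
Proof.
(* Truncating the label at [j] makes the angle a function of the preceding qudits alone. *)
move=> k0 v0 supp; pose t x := arg (givens_phase (amp v (upd j 0 (below j x)))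
                                       (amp v (upd j k (below j x)))).
have ht : dep_below j t.
  move=> x y e; rewrite /t; have -> // : below j x = below j y.
  by apply/ffunP => i; rewrite !ffunE; case: ifP => // /e.
pose U := ucop j (fun x => rot k (expi (t x))).
have hU : impl (uc_cost p j) U by apply: impl_rot.
have ct : ctrl j (fun x => rot k (expi (t x))).
  by move=> x b; rewrite (dep_ctrl (j := j) _ ht).
have k0' : (0 == k) = false by rewrite eq_sym (negPf k0).
have Usupp y (i : 'I_m) : (j < i)%N -> y i != 0 -> amp (U *m v) y = 0.
  move=> ji yi; rewrite amp_ucop // big1 // => b _.
  rewrite (supp _ i) ?mulr0 // upd_other //.
  by apply: contraTneq ji => ->; rewrite ltnn.
have Ukeep y : y j != 0 -> y j != k -> amp (U *m v) y = amp v y.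
  move=> y0 yk; rewrite amp_ucop // (bigD1 (y j)) //= big1 ?addr0.
    by rewrite mxE (negPf y0) (negPf yk) eqxx mul1r upd_id.
  by move=> b by_; rewrite mxE (negPf y0) (negPf yk) eq_sym (negPf by_) mul0r.
(* The truncation loses nothing on labels vanishing beyond [j]; on all others the amplitude is
   zero. *)
have plane y : (forall i : 'I_m, (j < i)%N -> y i = 0) ->
    forall b, upd j b (below j y) = upd j b y.
  move=> hy b; apply/ffunP => i; rewrite !ffunE; case: eqP => // /eqP ij.
  by case: ltngtP => // [/hy ->//|/val_inj]; move: ij => /eqP.
have two y (F : 'I_d -> C) : (forall b, b != 0 -> b != k -> F b = 0) ->
    \sum_b F b = F 0 + F k.
  move=> F0; rewrite (bigD1 0) //= (bigD1 k) //= big1 ?addr0 //.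
  by move=> b /andP[b0 bk]; apply: F0.
have Uplane y : (forall i : 'I_m, (j < i)%N -> y i = 0) ->
   (y j = 0 -> 0 <= amp (U *m v) y) /\ (y j = k -> amp (U *m v) y = 0).
  move=> hy; have := givens_phaseP (v0 (upd j 0 y)) (v0 (upd j k y)).
  rewrite -!(plane y hy) /=; case=> e1 e2 e3.
  have te : expi (t y) =
      givens_phase (amp v (upd j 0 (below j y))) (amp v (upd j k (below j y))).
    exact: expi_arg.
  split=> yj; rewrite amp_ucop // (two y); try by move=> b b0 bk;
    rewrite mxE yj ?k0' ?(negPf k0) ?eqxx /= (negPf b0) (negPf bk) ?mulr0n ?subr0 ?addr0 mul0r.
    rewrite !mxE yj /= k0' (negPf k0) !eqxx !mulr0n !mulr1n addr0 add0r te -!(plane y hy).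
    by rewrite e2 sqrtC_ge0 addr_ge0 ?exprn_ge0.
  rewrite !mxE yj /= k0' (negPf k0) !eqxx !mulr0n !mulr1n subr0 add0r te -!(plane y hy).
  by rewrite addrC mulNr.
have dec y : (exists2 i : 'I_m, (j < i)%N & y i != 0) \/
    (forall i : 'I_m, (j < i)%N -> y i = 0).
  case: (boolP [exists i : 'I_m, (j < i)%N && (y i != 0)]).
    by move=> /existsP[i /andP[ji yi]]; left; exists i.
  rewrite negb_exists => /forallP h; right=> i ji; have := h i.
  by rewrite ji negbK => /eqP.
exists U; split=> // y.
  have [[i ji yi]|hy] := dec y; first by rewrite (Usupp y i).
  have [y0|y0] := eqVneq (y j) 0; first exact: (Uplane y hy).1.
  have [yk|yk] := eqVneq (y j) k; first by rewrite (Uplane y hy).2.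
  by rewrite Ukeep.
move=> yk; have [[i ji yi]|hy] := dec y; first by rewrite (Usupp y i).
exact: (Uplane y hy).2.
Qed.

End Preparation.

(** * Householder reflections *)

Section Reflection.
Variables (R : realType) (p m : nat).
Local Notation C := R[i].
Local Notation d := p.+2.
Local Notation lab := (label d m).
Local Notation impl := (@impl R d m).
Implicit Types x y : lab.
Hypothesis d_prime : prime d.

(** Levels $1,\dots,d-1$, [p.+1] in number, are merged into level 0 one at a time. *)
Lemma sweep_qudit (j : 'I_m) (v : state C d m) :
  (forall y, 0 <= amp v y) ->
  (forall y (i : 'I_m), (j < i)%N -> y i != 0 -> amp v y = 0) ->
  exists U, [/\ impl (p.+1 * uc_cost p j) U, forall y, 0 <= amp (U *m v) y &
    forall y (i : 'I_m), (j <= i)%N -> y i != 0 -> amp (U *m v) y = 0].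
Proof.
move=> v0 supp.
suff H n : (n < d)%N -> exists U, [/\ impl (n * uc_cost p j) U,
    forall y, 0 <= amp (U *m v) y,
    forall y (i : 'I_m), (j < i)%N -> y i != 0 -> amp (U *m v) y = 0 &
    forall y, (0 < y j <= n)%N -> amp (U *m v) y = 0].
  have [U [U1 U2 U3 U4]] := H _ (ltnSn p.+1).
  exists U; split=> // y i; rewrite leq_eqVlt => /orP[/eqP/val_inj <- yj|]; last exact: U3.
  by apply: U4; rewrite -[(y j <= _)%N]ltnS ltn_ord lt0n andbT;
    apply: contraNneq yj => h; apply/eqP/val_inj.
elim: n => [|n IH] nd.
  exists 1%:M; rewrite mul1mx; split=> //; first exact: impl1.
  by move=> y /andP[y0]; rewrite leqNgt y0.
have [U [U1 U2 U3 U4]] := IH (ltnW nd).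
pose k : 'I_d := Ordinal nd.
have [W [W1 W2 W3 W4 W5]] := sweep_level d_prime (isT : k != 0) U2 U3.
exists (W *m U); rewrite -mulmxA; split=> //; first by rewrite mulSn; apply: implM.
move=> y /andP[y0]; rewrite leq_eqVlt => /orP[/eqP yk|yn].
  by apply: W4; apply: val_inj.
rewrite W5 ?U4 ?y0 //; first by apply: contraTneq y0 => ->.
by apply: contraTneq yn => ->; rewrite ltnn.
Qed.

(** Qudits are cleared from last to first, since a sweep of qudit [j] needs all later ones at 0 and
    uses the earlier ones as controls. *)
Lemma sweep_register (v : state C d m) : (forall y, 0 <= amp v y) ->
  exists U, impl (p.+1 * diag_cost p m) U /\
    forall y (i : 'I_m), y i != 0 -> amp (U *m v) y = 0.
Proof.
move=> v0.
suff H t : (t <= m)%N -> exists U,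
    [/\ impl (p.+1 * \sum_(m - t <= j < m) uc_cost p j) U, forall y, 0 <= amp (U *m v) y &
    forall y (i : 'I_m), (m - t <= i)%N -> y i != 0 -> amp (U *m v) y = 0].
  have [U [U1 U2 U3]] := H m (leqnn m).
  rewrite subnn in U1 U3; rewrite big_mkord in U1.
  by exists U; split=> // y i; apply: U3.
elim: t => [|t IH] tm.
  exists 1%:M; rewrite mul1mx subn0 big_geq // muln0; split=> //; first exact: impl1.
  by move=> y i; rewrite leqNgt ltn_ord.
have [U [U1 U2 U3]] := IH (ltnW tm).
have jm : (m - t.+1 < m)%N by lia.
have jS : (m - t.+1).+1 = (m - t)%N by lia.
pose j : 'I_m := Ordinal jm.
have [|W [W1 W2 W3]] := @sweep_qudit j _ U2.
  by move=> y i; rewrite /= jS; apply: U3.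
exists (W *m U); rewrite -mulmxA; split=> //.
by rewrite big_ltn // jS mulnDr; apply: implM.
Qed.

Lemma amp_inj (v w : state C d m) : amp v =1 amp w -> v = w.
Proof.
move=> e; apply/matrixP=> i z; rewrite ord1.
by have := e (enum_val i); rewrite /amp enum_valK.
Qed.

Lemma ampD (v w : state C d m) y : amp (v + w) y = amp v y + amp w y.
Proof. by rewrite /amp mxE. Qed.

Lemma ampZ a (v : state C d m) y : amp (a *: v) y = a * amp v y.
Proof. by rewrite /amp mxE. Qed.

Lemma amp_ket0 y : amp (ket0 R d m) y = [forall k, y k == 0]%:R.
Proof. by rewrite /amp mxE enum_rankK. Qed.

Definition zero_label : lab := [ffun=> 0].

Lemma ket0_dual (z : state C d m) : (ket0 R d m)^t* *m z = (amp z zero_label)%:M.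
Proof.
apply/matrixP=> i k; rewrite !ord1 !mxE (reindex _ (onW_bij _ (@enum_rank_bij _))) /=.
rewrite (bigD1 zero_label) //= big1 ?addr0.
  rewrite !mxE enum_rankK; have -> : [forall k, zero_label k == 0 :> nat].
    by apply/forallP => j; rewrite ffunE.
  by rewrite rmorph1 mul1r mulr1n.
move=> y yz; rewrite !mxE enum_rankK; case: (boolP [forall k, _]) => [/forallP h|_].
  by case/eqP: yz; apply/ffunP => j; rewrite ffunE; apply/val_inj/eqP/h.
by rewrite rmorph0 mul0r.
Qed.

Lemma ket0_norm : (ket0 R d m)^t* *m ket0 R d m = 1%:M.
Proof.
rewrite ket0_dual amp_ket0; have -> : [forall k, zero_label k == 0].
  by apply/forallP => j; rewrite ffunE.
by [].
Qed.

(** One diagonal operator makes the amplitudes nonnegative and the sweep costs $d-1$ times as much,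
    hence the factor [d]. *)
Lemma impl_to_ket0 (w : state C d m) : (0 < m)%N ->
  exists U c, impl (d * diag_cost p m) U /\ U *m w = c *: ket0 R d m.
Proof.
move=> m0; have [t ht] := fin_all_exists (fun y => polar (amp w y)).
have D := impl_diagop d_prime t m0.
have [|U [hU z]] := @sweep_register (diagop t *m w).
  by move=> y; rewrite amp_diagop ht normr_ge0.
exists (U *m diagop t), (amp (U *m diagop t *m w) zero_label); split.
  by rewrite mulSn addnC; apply: implM.
apply: amp_inj => y; rewrite ampZ amp_ket0.
case: (boolP [forall k, _]) => [/forallP h|].
  have -> : y = zero_label by apply/ffunP => j; rewrite ffunE; apply/eqP/h.
  by rewrite mulr1.
by rewrite negb_forall mulr0 => /existsP[i yi]; rewrite -mulmxA (z _ i).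
Qed.

(** A circuit to $|0\dots0\rangle$, its adjoint, and a diagonal operator between them. *)
Definition refl_cost := (2 * (d * diag_cost p m) + diag_cost p m)%N.

Lemma diagop_ket0 t (z : state C d m) :
  diagop (fun x : lab => if [forall k, x k == 0] then t else 0) *m z =
  z + (expi t - 1) *: (ket0 R d m *m ((ket0 R d m)^t* *m z)).
Proof.
rewrite ket0_dual mul_mx_scalar; apply: amp_inj => y.
rewrite amp_diagop ampD !ampZ amp_ket0.
case: (boolP [forall k, _]) => [/forallP h|_].
  have -> : y = zero_label by apply/ffunP => j; rewrite ffunE; apply/eqP/h.
  by rewrite mulr1 mulrBl mul1r addrC subrK.
by rewrite expi0 !mulr0 mul1r addr0.
Qed.

(** If [U] sends [w] to $c|0\dots0\rangle$, conjugation by [U] moves the phase on $|0\dots0\rangle$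
    to the line of [w]; the unknown [c] cancels as $|c|^2=w^\dagger w$. *)
Lemma impl_phase_on (w : state C d m) t : (0 < m)%N -> w != 0 ->
  exists2 H, impl refl_cost H & forall z : state C d m,
    H *m z = z + (expi t - 1) / (w^t* *m w) 0 0 *: (w *m (w^t* *m z)).
Proof.
move=> m0 w0; have [U [c [hU Uw]]] := impl_to_ket0 w m0.
have uU := impl_unitary hU.
have U1 := unitarymxPl _ uU.
have c0 : c != 0.
  apply: contraNneq w0 => c0; rewrite -[w]mul1mx -U1 -mulmxA Uw c0 scale0r.
  by rewrite mulmx0.
have wE : w = c *: (U^t* *m ket0 R d m) by rewrite scalemxAr -Uw mulmxA U1 mul1mx.
have wH : w^t* = c^* *: ((ket0 R d m)^t* *m U).
  by rewrite wE linearZ /= map_mxZ adjM trmxCK.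
have ww : (w^t* *m w) 0 0 = c * c^*.
  rewrite wH -scalemxAl -mulmxA Uw -scalemxAr ket0_norm scalerA mulrC.
  by rewrite !mxE mulr1.
exists (U^t* *m (diagop (fun x : lab => if [forall k, x k == 0] then t else 0) *m U)).
  have hD := impl_diagop d_prime (fun x : lab => if [forall k, x k == 0] then t else 0) m0.
  have := implM (impl_adj hU) (implM hD hU); apply: impl_leq.
  by rewrite /refl_cost; lia.
move=> z; rewrite -!mulmxA diagop_ket0 mulmxDr mulmxA U1 mul1mx; congr (_ + _).
rewrite ww wH {1}wE -!scalemxAr -!scalemxAl -!scalemxAr !scalerA -!mulmxA; congr (_ *: _).
by field; rewrite conjC_eq0 c0.
Qed.

(** A complex Householder reflection along $w=u-v$: a suitable phase in place of $-1$ sends [u]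
    exactly to [v], and vectors orthogonal to [w] are fixed. *)
Lemma impl_reflection (u v : state C d m) : (0 < m)%N -> u^t* *m u = v^t* *m v ->
  exists2 H, impl refl_cost H & H *m u = v /\
    forall z : state C d m, u^t* *m z = 0 -> v^t* *m z = 0 -> H *m z = z.
Proof.
move=> m0 uv; have [<-|nuv] := eqVneq u v.
  exists 1%:M; first by apply: impl_leq (impl1 _ _ _).
  by split=> [|z _ _]; rewrite mul1mx.
pose w := u - v; have w0 : w != 0 by rewrite subr_eq0.
pose a := (w^t* *m u) 0 0.
have adjB : w^t* = u^t* - v^t* by rewrite /w linearB /= map_mxB.
have aE : a = (u^t* *m u) 0 0 - (v^t* *m u) 0 0 by rewrite /a adjB mulmxBl !mxE.
have aC : a^* = (u^t* *m u) 0 0 - (u^t* *m v) 0 0.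
  have -> : a^* = ((w^t* *m u)^t*) 0 0 by rewrite [RHS]mxE [in RHS]mxE.
  by rewrite adjM trmxCK mulmxBr !mxE.
(* The equality of norms enters here. *)
have ww : (w^t* *m w) 0 0 = a + a^*.
  rewrite aC aE adjB mulmxBl !mulmxBr -uv !mxE; ring.
have w_gt0 : (w^t* *m w) 0 0 != 0.
  apply: contraNneq w0 => e; apply/eqP/matrixP => i z; rewrite ord1 [RHS]mxE.
  move/eqP: e; rewrite mxE psumr_eq0 => [/allP/(_ i (mem_index_enum i))|k _].
    by rewrite !mxE mulrC -normCK expf_eq0 normr_eq0 => /eqP.
  by rewrite !mxE mulrC -normCK exprn_ge0.
have a0 : a != 0.
  by apply: contraNneq w_gt0 => e; rewrite ww e conjC0 addr0.
have ac0 : a^* != 0 by rewrite conjC_eq0.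
(* This phase solves $(e^{it}-1)a/(a+\bar a)=-1$, so that $Hu=u-w=v$. *)
pose t := arg (- (a^* / a)).
have te : expi t = - (a^* / a).
  apply: expi_arg; rewrite rmorphN rmorphM rmorphV ?unitfE //= conjCK mulrNN.
  by field; rewrite a0 ac0.
have [H hH HE] := impl_phase_on t m0 w0.
exists H => //; split=> [|z uz vz]; last first.
  have wz : w^t* *m z = 0 by rewrite adjB mulmxBl uz vz subr0.
  by rewrite HE wz mulmx0 scaler0 addr0.
rewrite HE [w^t* *m u]mx11_scalar -/a mul_mx_scalar scalerA te ww.
have -> : (- (a^* / a) - 1) / (a + a^*) * a = -1.
  by rewrite ww in w_gt0; field; rewrite a0 w_gt0.
by rewrite scaleN1r /w opprB addrC subrK.
Qed.

(** The reflection for column [k] fixes the earlier columns: they already agree with those of [T],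
    hence are orthogonal to both the current and the desired column [k]. *)
Lemma impl_isometry n (S T : operator C d n m) : (0 < m)%N ->
  is_isometry S -> is_isometry T ->
  exists2 U, impl (d ^ n * refl_cost) U & U *m S = T.
Proof.
move=> m0 hS hT.
suff H t : (t <= #|label d n|)%N -> exists2 U, impl (t * refl_cost) U &
    forall i : 'I_#|label d n|, (i < t)%N -> col i (U *m S) = col i T.
  have [U hU e] := H _ (leqnn _).
  rewrite card_ffun !card_ord in hU; exists U => //.
  apply/matrixP => i k; have := e k (ltn_ord k).
  by move=> /matrixP/(_ i 0); rewrite !mxE.
elim: t => [|t IH] tn; first by exists 1%:M => //; apply: impl1.
have [U hU e] := IH (ltnW tn); pose k := Ordinal tn.
have US : (U *m S)^t* *m (U *m S) = 1%:M.
  by rewrite adjM mulmxA -[X in X *m S]mulmxA (unitarymxPl _ (impl_unitary hU)) mulmx1.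
have col_mul (A : operator C d m m) (B : operator C d n m) i :
    col i (A *m B) = A *m col i B by rewrite !colE mulmxA.
have col_dot (A B : operator C d n m) i l :
    (col i A)^t* *m col l B = const_mx ((A^t* *m B) i l).
  apply/matrixP => r s; rewrite !mxE; apply: eq_bigr => q _; by rewrite !mxE.
have [|W hW [Wu Wz]] := @impl_reflection (col k (U *m S)) (col k T) m0.
  by rewrite !col_dot US hT.
exists (W *m U); first by rewrite mulSn; apply: implM.
move=> i; rewrite ltnS leq_eqVlt => /orP[/eqP it|it].
  have -> : i = k by apply: val_inj.
  by rewrite -mulmxA col_mul Wu.
have ki : (k == i) = false by apply/eqP => ki; rewrite -ki /= ltnn in it.
rewrite -mulmxA col_mul (e i it) Wz //.
  by rewrite -(e i it) col_dot US mxE ki; apply/matrixP => r s; rewrite !mxE.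
by rewrite col_dot hT mxE ki; apply/matrixP => r s; rewrite !mxE.
Qed.

End Reflection.

(** * Adjoining ancillas as an isometry *)

Section Embedding.
Variables (R : realType) (p q n m : nat) (e : (q + n)%N = m).
Local Notation C := R[i].
Local Notation d := p.+2.

Definition embed (y : label d n) : label d m :=
  [ffun i => if split (cast_ord (esym e) i) is inr k then y k else 0].

Lemma embed_shift y k : embed y (cast_ord e (rshift q k)) = y k.
Proof.
rewrite ffunE cast_ordK.
have -> : rshift q k = unsplit (inr k) by [].
by rewrite unsplitK.
Qed.

Lemma embed_inj : injective embed.
Proof. by move=> y z yz; apply/ffunP => k; rewrite -!embed_shift yz. Qed.

Lemma embedP x y : (x == embed y) =
  [forall k, x (cast_ord e (lshift n k)) == 0] &&
  ([ffun i => x (cast_ord e (rshift q i))] == y).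
Proof.
apply/eqP/andP => [->|[/forallP x0 /eqP <-]].
  split; last by apply/eqP/ffunP => k; rewrite ffunE embed_shift.
  apply/forallP => k; rewrite ffunE cast_ordK.
  have -> : lshift n k = unsplit (inl k) by [].
  by rewrite unsplitK.
apply/ffunP => i; rewrite ffunE -{1}(cast_ordKV e i).
rewrite -{1}(splitK (cast_ord (esym e) i)); case: (split _) => k /=.
  exact/eqP/x0.
by rewrite ffunE.
Qed.

Definition embed_op : operator C d n m := mkop (fun x y => (x == embed y)%:R).

Lemma embed_op_isometry : is_isometry embed_op.
Proof.
apply/matrixP=> i k; rewrite !mxE (reindex _ (onW_bij _ (@enum_rank_bij _))) /=.
rewrite (bigD1 (embed (enum_val i))) //= big1 ?addr0.
  rewrite !mxE !enum_rankK eqxx rmorph1 mul1r; congr (nat_of_bool _)%:R.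
  by rewrite (inj_eq embed_inj) (inj_eq enum_val_inj).
by move=> x /negPf xi; rewrite !mxE enum_rankK xi rmorph0 mul0r.
Qed.

Lemma embed_opE psi : embed_op *m psi = tensor e (ket0 R d q) psi.
Proof.
apply: amp_inj => x; rewrite [RHS]/amp mxE enum_rankK amp_ket0.
rewrite /amp mxE (reindex _ (onW_bij _ (@enum_rank_bij _))) /=.
have -> : [forall k, [ffun i => x (cast_ord e (lshift n i))] k == 0] =
          [forall k, x (cast_ord e (lshift n k)) == 0].
  by apply: eq_forallb => k; rewrite ffunE.
set y := [ffun i => x (cast_ord e (rshift q i))].
rewrite (bigD1 y) //= big1 ?addr0 => [|z zy].
  by rewrite mxE !enum_rankK embedP -/y eqxx andbT.
by rewrite mxE !enum_rankK embedP -/y [y == z]eq_sym (negPf zy) andbF mul0r.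
Qed.

End Embedding.

(** * Comparison with the stated bound *)

Lemma diag_costE p m : (diag_cost p m.+1).+1 = (\sum_(j < m.+1) p.+2 ^ j)%N.
Proof.
rewrite /diag_cost !big_ord_recl /uc_cost /= mul0n add0n expn0 add1n; congr _.+1.
by apply: eq_bigr => j _; rewrite /= mul1n.
Qed.

(** By $N_U\ge2$ it suffices that $(2d+1)(S-1)\le d(4(S-m)+2)$ with $S=1+d+\dots+d^{m-1}$; [key] is
    this inequality rearranged without subtracting $m$. *)
Lemma refl_cost_leq p m : (0 < m)%N ->
  (refl_cost p m <= p.+2 * (4 * ((p.+2 ^ m - 1) %/ (p.+2 - 1) - m) + N_U p.+2 m))%N.
Proof.
case: m => // m _; rewrite /N_U; set N := (\sum_(3 <= r < _) _)%N.
rewrite [(_ ^ _ - 1)%N]subn1 predn_exp subn1 /= mulKn //.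
have := diag_costE p m; set S := (\sum_(i < _) _)%N; rewrite /refl_cost => DS.
have SD : diag_cost p m.+1 = (S - 1)%N by rewrite -DS subn1.
have mS : (m.+1 <= S)%N.
  rewrite -[X in (X <= _)%N]card_ord -sum1_card; apply: leq_sum => i _.
  by rewrite expn_gt0.
have key : (4 * p.+2 * m.+1 <= (2 * p.+2 - 1) * S + 4 * p.+2 + 1)%N.
  (* The increment $4d\le(2d-1)d^M$ from length $M$ to $M+1$ fails for $d=2$, $M=1$, so lengths 1
     and 2 are both base cases. *)
  rewrite /S {S DS SD mS}; case: m {N} => [|m]; first by rewrite big_ord1; lia.
  elim: m => [|m IH]; first by rewrite !big_ord_recr big_ord0 /=; nia.
  rewrite big_ord_recr /= mulnDr.
  have : (4 * p.+2 <= (2 * p.+2 - 1) * p.+2 ^ m.+2)%N.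
    have h : (p.+2 ^ 1 <= p.+2 ^ m.+1)%N by rewrite leq_exp2l.
    by rewrite expnS mulnCA mulnC leq_mul2l /=; nia.
  move: IH; set A := (\sum_(i < _) _)%N; lia.
rewrite SD; move: S mS key {DS SD} => S mS key; nia.
Qed.

Theorem corollaryV4 (R : realType) (d n m : nat) (hd : prime d)
    (hn : (1 <= n)%N) (hnm : (n <= m)%N)
    (V : operator (R[i])%C d n m) (hV : is_isometry V) :
  exists c : circuit R d m,
    implements hnm c V /\ (sum_count c <= d * N_isometry d n m)%N.
Proof.
(* Writing the prime as [p.+2] gives ['I_d] its ring structure. *)
case: d hd V hV => [|[|p]] // d_prime V hV.
have m0 := leq_trans hn hnm.
have [U [c cU hc] UT] :=
  impl_isometry d_prime m0 (embed_op_isometry R p (subnK hnm)) hV.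
exists c; split=> [psi|]; first by rewrite -embed_opE mulmxA cU UT.
apply: (leq_trans hc); rewrite /N_isometry -mulnA mulnCA -mulnDr [(_ * (_ ^ n * _))%N]mulnCA.
by rewrite leq_mul2l refl_cost_leq ?orbT.
Qed.
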